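(* There is a universal constant $c>0$ such that for all integers $K\ge1$ and $L\ge2$, the zero-range process with constant rate $1$ on the complete graph with $L$ sites and $K$ particles satisfies the modified logarithmic Sobolev inequality $\mathrm{MLSI}\big(\frac{c}{K^2L\log L}\big)$.
   Context: Zero-range process: the state space is $\mathcal X_{K,L}=\{\eta\in\mathbb N^L:\sum_{i=1}^L\eta_i=K\}$ (with $0\in\mathbb N$). For $\eta\in\mathcal X_{K,L}$, $i\ne j$ with $\eta_i\ge1$, $\eta^{i,j}$ denotes the configuration obtained from $\eta$ by moving one particle from site $i$ to site $j$. The transition rates for $\eta\ne\eta'$ are $Q_{K,L}(\eta,\eta')=\frac1L$ if $\eta'=\eta^{i,j}$ for some such $i,j$, and $0$ otherwise ($Q_{K,L}(\eta,\eta)=0$). The invariant (reversible) measure $\pi_{K,L}$ is the uniform probability measure on $\mathcal X_{K,L}$. For a finite reversible chain $(\mathcal X,Q,\pi)$, let $\mathcal E(\phi,\psi)=\frac12\sum_{x,y}(\phi(y)-\phi(x))(\psi(y)-\psi(x))Q(x,y)\pi(x)$ and $\mathcal H(\rho)=\sum_x\pi(x)\rho(x)\log\rho(x)$. $\mathrm{MLSI}(\lambda)$ means: $\mathcal H(\rho)\le\frac1{2\lambda}\mathcal E(\rho,\log\rho)$ for all strictly positive $\rho:\mathcal X\to(0,\infty)$ with $\sum_x\rho(x)\pi(x)=1$. ''Universal'' means independent of $K$ and $L$. *)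

(* Defs.v *)
From mathcomp Require Import all_boot all_order all_algebra.
From mathcomp Require Import reals exp.

Set Implicit Arguments.
Unset Strict Implicit.
Unset Printing Implicit Defensive.

Import Order.TTheory GRing.Theory Num.Theory.
Local Open Scope ring_scope.

Definition dirichlet (R : realType) (X : finType) (Q : X -> X -> R)
    (pi : X -> R) (phi psi : X -> R) : R :=
  2^-1 * \sum_(x : X) \sum_(y : X)
    (phi y - phi x) * (psi y - psi x) * Q x y * pi x.

Definition entropy (R : realType) (X : finType) (pi : X -> R)
    (rho : X -> R) : R :=
  \sum_(x : X) pi x * rho x * ln (rho x).

Definition MLSI (R : realType) (X : finType) (Q : X -> X -> R)
    (pi : X -> R) (lambda : R) : Prop :=
  forall rho : X -> R,
    (forall x, 0 < rho x) ->
    \sum_(x : X) rho x * pi x = 1 ->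
    entropy pi rho <=
      (2 * lambda)^-1 * dirichlet Q pi rho (fun x => ln (rho x)).

(* The values are taken in ['I_K.+1] rather than [nat] only to obtain a
   [finType]: a summand of [K] never exceeds [K]. *)
Definition config (K L : nat) : finType :=
  {eta : {ffun 'I_L -> 'I_K.+1} | (\sum_(i < L) eta i)%N == K}.

Definition occ (K L : nat) (eta : config K L) (i : 'I_L) : nat :=
  val eta i.

(* Truncated subtraction: only meaningful when [0 < occ eta i]. *)
Definition move (K L : nat) (eta : config K L) (i j : 'I_L) : 'I_L -> nat :=
  fun k => (occ eta k - (k == i) + (k == j))%N.

(* Distinct pairs (i, j) lead to distinct configurations, so no transition is
   counted twice; the diagonal vanishes because of [i != j]. *)
Definition zrp_rate (R : realType) (K L : nat) (eta eta' : config K L) : R :=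
  if [exists i, exists j, [&& i != j, (0 < occ eta i)%N
        & [forall k, occ eta' k == move eta i j k]]]
  then L%:R^-1 else 0.

Definition zrp_measure (R : realType) (K L : nat) (eta : config K L) : R :=
  #|{: config K L}|%:R^-1.

(* Main.v *)
Require Import Defs.
From mathcomp Require Import all_boot all_order all_algebra.
From mathcomp Require Import reals exp.
From mathcomp Require Import ring lra zify.

Set Implicit Arguments.
Unset Strict Implicit.
Unset Printing Implicit Defensive.

Import Order.TTheory GRing.Theory Num.Theory.
Local Open Scope ring_scope.

(** The proof establishes a logarithmic Sobolev inequality for the square root of
    rho, which is stronger since (a - b) (ln a - ln b) dominates the squared
    Hellinger distance (sqrt a - sqrt b)^2 ([hellinger_le_ln]).

    Condition on the occupation of the first site. By the chain rule, the entropy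
    is the mean of the conditional entropies, which concern fewer sites, plus the
    entropy of the conditional averages, a function of one integer n (the number
    of particles outside the first site) under the weights v_n, the number of
    ways to place n particles on the remaining sites. The argument therefore
    needs two ingredients.

    One is a logarithmic Sobolev inequality on a segment of N points for weights
    that are nondecreasing, log-concave and grow by a factor at most B per step
    ([line_log_sobolev]); its constant is of order N^2 (1 + ln B). It is obtained
    by cutting the segment recursively. At each cut the two-point inequality
    ([two_point]) costs the logarithm of the inverse mass of the lighter part,
    which [balanced_split] keeps of order B, and the two averages are compared
    along paths ([cross_hellinger]). With at most L sites one has B <= L, whence
    the factor ln L, and N <= K + 1 gives the factor K^2.

    The other is the comparison of consecutive conditional averages. The uniform
    measures with n and n + 1 particles are coupled by the Polya urn ([urn]),
    which adds one particle; together with its removal from the first site this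
    is exactly one jump of the process. Since the squared Hellinger distance is
    jointly convex, the increment of the averages is bounded by the energy of
    these jumps ([coupling]).

    In the induction over the sites ([comps_log_sobolev]) every jump is used at
    most once, so the constant is that of the segment. The last factor L comes
    from the jump rate 1/L. *)

(** * The squared Hellinger distance *)

Section Hellinger.
Variable R : realType.
Implicit Types a b c d w x y : R.

Definition hellinger a b : R := (Num.sqrt a - Num.sqrt b) ^+ 2.

Lemma hellinger_ge0 a b : 0 <= hellinger a b.
Proof. exact: sqr_ge0. Qed.

Lemma hellingerE a b : 0 <= a -> 0 <= b ->
  hellinger a b = a + b - 2 * (Num.sqrt a * Num.sqrt b).
Proof.
by move=> a0 b0; rewrite /hellinger -{2}(sqr_sqrtr a0) -{2}(sqr_sqrtr b0); ring.
Qed.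

Lemma hellingerZ w a b : 0 <= w -> hellinger (w * a) (w * b) = w * hellinger a b.
Proof.
move=> w0; rewrite /hellinger !sqrtrM// -mulrBr exprMn sqr_sqrtr//.
Qed.

(** The squared Hellinger distance is convex and homogeneous of degree one, hence
    subadditive. This is what lets a distance between averages be bounded by
    the average distance over a coupling. *)
Lemma hellingerD a b c d : 0 <= a -> 0 <= b -> 0 <= c -> 0 <= d ->
  hellinger (a + c) (b + d) <= hellinger a b + hellinger c d.
Proof.
move=> a0 b0 c0 d0; rewrite !hellingerE ?addr_ge0// -sqrtrM ?addr_ge0//.
set x := Num.sqrt a; set y := Num.sqrt b.
set z := Num.sqrt c; set u := Num.sqrt d.
have cs : x * y + z * u <= Num.sqrt ((a + c) * (b + d)).
  (* Cauchy-Schwarz, from the square of the determinant x u - y z. *)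
  have xyzu : 0 <= x * y + z * u by rewrite addr_ge0// mulr_ge0 ?sqrtr_ge0.
  rewrite -[leLHS]ger0_norm// -sqrtr_sqr.
  rewrite ler_sqrt ?mulr_ge0 ?addr_ge0//.
  rewrite -(sqr_sqrtr a0) -(sqr_sqrtr b0) -(sqr_sqrtr c0) -(sqr_sqrtr d0).
  by rewrite -/x -/y -/z -/u -subr_ge0; have := sqr_ge0 (x * u - y * z); nra.
lra.
Qed.

Lemma hellinger_sum (I : Type) (r : seq I) (F G : I -> R) :
  (forall i, 0 <= F i) -> (forall i, 0 <= G i) ->
  hellinger (\sum_(i <- r) F i) (\sum_(i <- r) G i) <=
  \sum_(i <- r) hellinger (F i) (G i).
Proof.
move=> F0 G0; elim: r => [|i r IH].
  by rewrite !big_nil /hellinger subrr expr0n.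
rewrite !big_cons; apply: le_trans (hellingerD _ _ _ _) _; rewrite ?sumr_ge0//.
by rewrite lerD2l.
Qed.

(** The length of the path appears only to the first power because this is a
    Cauchy-Schwarz bound on square roots; no such bound holds for
    (a - b) (ln a - ln b), which is why the whole proof runs through square
    roots. *)
Lemma hellinger_path (g : nat -> R) s k :
  hellinger (g s) (g (s + k)%N) <=
  k%:R * \sum_(s <= i < s + k) hellinger (g i) (g i.+1).
Proof.
elim: k => [|k IH]; first by rewrite addn0 /hellinger subrr expr0n mul0r.
rewrite addnS big_nat_recr ?leq_addr//=.
move: IH; rewrite /hellinger; set S := \sum_(_ <= _ < _) _.
set p := Num.sqrt (g s); set r := Num.sqrt (g (s + k)%N).
set t := Num.sqrt _ => IH.
rewrite -natr1; case: k @S @r @t IH => [|k] S r t IH.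
  have S0 : S = 0 by rewrite /S addn0 big_geq.
  move: IH; rewrite S0 mul0r => IH.
  have /eqP : (p - r) ^+ 2 = 0 by apply/eqP; rewrite eq_le IH sqr_ge0.
  by rewrite sqrf_eq0 subr_eq0 => /eqP ->; rewrite !add0r mul1r.
(* AM-GM between the first k steps and the last one. *)
move: (sqr_ge0 ((p - r) - k.+1%:R * (r - t))) IH.
have : (0 : R) < k.+1%:R by rewrite ltr0n.
move: (k.+1%:R : R) => m m0 h1 h2.
rewrite -(ler_pM2l m0).
have := h2; rewrite -(ler_pM2l (ltr_wpDl ler01 m0)); nra.
Qed.

Lemma ln_leB1 x : 0 < x -> ln x <= x - 1.
Proof.
move=> x0; have := @le_ln1Dx R (x - 1); have -> : 1 + (x - 1) = x by ring.
by apply; lra.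
Qed.

(** The only link with the modified Dirichlet form: each of its summands
    dominates the corresponding squared increment of the square root. *)
Lemma hellinger_le_ln a b : 0 < a -> 0 < b ->
  hellinger a b <= (a - b) * (ln a - ln b).
Proof.
wlog ab : a b / b <= a => [wl a0 b0|a0 b0].
  case: (leP b a) => [|/ltW] ab; first exact: wl.
  have -> : hellinger a b = hellinger b a by rewrite /hellinger; ring.
  have -> : (a - b) * (ln a - ln b) = (b - a) * (ln b - ln a) by ring.
  exact: wl.
rewrite /hellinger.
have := sqr_sqrtr (ltW a0); have := sqr_sqrtr (ltW b0).
have : Num.sqrt b <= Num.sqrt a by rewrite ler_sqrt// ltW.
have : 0 < Num.sqrt b by rewrite sqrtr_gt0.
have : 0 < Num.sqrt a by rewrite sqrtr_gt0.
move: (Num.sqrt a) (Num.sqrt b) => u w u0 w0 wu Eb Ea.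
rewrite -{}Ea -{}Eb !lnXn//.
have h : 1 - w / u <= ln u - ln w.
  have := ln_leB1 (divr_gt0 w0 u0).
  by rewrite ln_div ?posrE//; lra.
have uw0 : 0 <= u ^+ 2 - w ^+ 2 by nra.
apply: (@le_trans _ _ ((u ^+ 2 - w ^+ 2) * (2 * (1 - w / u)))).
  have -> : (u ^+ 2 - w ^+ 2) * (2 * (1 - w / u)) =
    2 * (u + w) / u * (u - w) ^+ 2 by field; rewrite gt_eqF.
  rewrite ler_peMl ?sqr_ge0// ler_pdivlMr//; lra.
apply: ler_wpM2l => //; rewrite !mulr2n; lra.
Qed.

(** * The entropy of a two-block partition *)

(** The entropy of a function with block sums [x] over blocks of mass [w] is the
    sum of the [relent x w] minus the same expression for the total; with
    unnormalised sums the chain rule for entropy is a telescoping identity. *)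
Definition relent x w : R := x * ln (x / w).

(** Logarithmic Sobolev inequality on two points, with the sharp order ln M when
    the lighter point has relative mass 1/M. If the larger value is at most four
    times the mean, bounding ln u by u - 1 already gives a variance bound. If
    not, the larger value sits on a block of mass below 1/4 and far exceeds the
    smaller one: then its block contributes at most its sum times ln M, and its
    Hellinger distance to the smaller value is comparable to itself. *)
Lemma two_point_avg M a b V W : 0 < a -> 0 < b -> 0 < V -> 0 < W ->
  V + W <= M * V -> V + W <= M * W -> b <= a ->
  let m := (V * a + W * b) / (V + W) in
  V * a * ln (a / m) + W * b * ln (b / m) <=
  16 * (1 + ln M) * (V * W * hellinger a b / (V + W)).
Proof.
move=> a0 b0 V0 W0 MV MW ba; set m := (V * a + W * b) / (V + W); rewrite /=.
have T0 : 0 < V + W by lra.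
have Em : (V + W) * m = V * a + W * b by rewrite /m; field; rewrite gt_eqF.
have m0 : 0 < m by rewrite divr_gt0// addr_gt0// mulr_gt0.
have bm : b <= m by rewrite -(ler_pM2l T0) Em; nra.
have M1 : 1 <= M by rewrite -(ler_pM2r V0); lra.
have lM : 0 <= ln M by rewrite ln_ge0.
have h0 : 0 <= V * W * hellinger a b / (V + W).
  apply: divr_ge0; last exact: ltW.
  by rewrite mulr_ge0 ?hellinger_ge0 // mulr_ge0 // ltW.
have lbm : ln (b / m) <= b / m - 1 by rewrite ln_leB1// divr_gt0.
have [am|am] := leP a (4 * m).
  have lam : ln (a / m) <= a / m - 1 by rewrite ln_leB1// divr_gt0.
  apply: (@le_trans _ _ (16 * (V * W * hellinger a b / (V + W)))); last first.
    by apply: ler_wpM2r => //; lra.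
  apply: (@le_trans _ _ (V * a * (a / m - 1) + W * b * (b / m - 1))).
    by apply: lerD; apply: ler_wpM2l => //; rewrite mulr_ge0// ltW.
  have -> : V * a * (a / m - 1) + W * b * (b / m - 1) =
     V * W * ((a - b) ^+ 2 / m) / (V + W).
    have m0' : m != 0 by rewrite gt_eqF.
    have T0' : V + W != 0 by rewrite gt_eqF.
    apply: (mulIf m0'); apply: (mulIf T0').
    have -> : (V * a * (a / m - 1) + W * b * (b / m - 1)) * m * (V + W)
      = (V * a ^+ 2 + W * b ^+ 2 - (V * a + W * b) * m) * (V + W) by field.
    rewrite mulrBl -[_ * m * _]mulrA [m * _]mulrC Em; field.
    by rewrite T0'.
  rewrite mulrA [16 * _]mulrCA; apply: ler_wpM2r; first by rewrite invr_ge0 ltW.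
  apply: ler_wpM2l; first by rewrite mulr_ge0 ?ltW.
  rewrite ler_pdivrMr// /hellinger.
  have := sqr_sqrtr (ltW a0); have := sqr_sqrtr (ltW b0).
  move: (Num.sqrt a) (Num.sqrt b) => u w Eb Ea.
  have -> : (a - b) ^+ 2 = (u - w) ^+ 2 * (u + w) ^+ 2 by rewrite -Ea -Eb; ring.
  have -> : 16 * (u - w) ^+ 2 * m = (u - w) ^+ 2 * (16 * m) by ring.
  apply: ler_wpM2l; first exact: sqr_ge0.
  apply: (@le_trans _ _ (2 * (a + b))); last by lra.
  by rewrite -Ea -Eb -subr_ge0; have := sqr_ge0 (u - w); nra.
have lb : W * b * ln (b / m) <= 0.
  apply: mulr_ge0_le0; first by rewrite mulr_ge0// ltW.
  by rewrite ln_le0// ler_pdivrMr// mul1r.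
have la : V * a * ln (a / m) <= V * a * ln M.
  apply: ler_wpM2l; first by rewrite mulr_ge0// ltW.
  have am0 : 0 < a / m by exact: divr_gt0.
  rewrite ler_ln ?posrE//; last by lra.
  rewrite ler_pdivrMr// -(ler_pM2l T0).
  have -> : (V + W) * (M * m) = M * (V * a + W * b) by rewrite -Em; ring.
  have h1 : (V + W) * a <= M * V * a by rewrite ler_wpM2r// ltW.
  have h2 : 0 <= M * (W * b) by rewrite mulr_ge0 ?mulr_ge0 ?ltW//; lra.
  lra.
apply: (@le_trans _ _ (V * a * ln M)); first by lra.
apply: (@le_trans _ _ (ln M * (16 * (V * W * hellinger a b / (V + W))))); last by lra.
rewrite mulrC; apply: ler_wpM2l => //.
have V4 : 4 * V <= V + W by nra.
have h4 : a <= 4 * hellinger a b.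
  have := sqr_sqrtr (ltW a0); have := sqr_sqrtr (ltW b0); rewrite /hellinger.
  have := sqrtr_ge0 a; have := sqrtr_ge0 b.
  move: (Num.sqrt a) (Num.sqrt b) => u w w0 u0 Eb Ea.
  rewrite -{1}Ea.
  have : 2 * w <= u by nra.
  nra.
rewrite [leRHS]mulrA ler_pdivlMr//.
apply: (@le_trans _ _ (V * (4 * hellinger a b) * (2 * W))).
  apply: ler_pM; [|exact: ltW| |by lra].
    by rewrite mulr_ge0// ltW.
  by rewrite ler_wpM2l// ltW.
have : 0 <= V * W * hellinger a b by rewrite mulr_ge0 ?hellinger_ge0// mulr_ge0// ltW.
lra.
Qed.

Lemma two_point M x y V W : 0 < x -> 0 < y -> 0 < V -> 0 < W ->
  V + W <= M * V -> V + W <= M * W ->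
  relent x V + relent y W - relent (x + y) (V + W) <=
  16 * (1 + ln M) * (hellinger (W * x) (V * y) / (V + W)).
Proof.
wlog xy : x y V W / y / W <= x / V => [wl|] x0 y0 V0 W0 MV MW.
  case: (leP (y / W) (x / V)) => [|/ltW] h; first exact: wl.
  rewrite [relent x V + _]addrC [x + y]addrC [V + W]addrC.
  have -> : hellinger (W * x) (V * y) = hellinger (V * y) (W * x).
    by rewrite /hellinger; ring.
  by apply: wl => //; rewrite addrC.
have T0 : 0 < V + W by lra.
have [V0' W0' T0'] : [/\ V != 0, W != 0 & V + W != 0] by rewrite !gt_eqF.
have := two_point_avg (divr_gt0 x0 V0) (divr_gt0 y0 W0) V0 W0 MV MW xy.
have -> : V * (x / V) = x by field.
have -> : W * (y / W) = y by field.
rewrite -hellingerZ; last by rewrite mulr_ge0// ltW.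
have -> : V * W * (x / V) = W * x by field.
have -> : V * W * (y / W) = V * y by field.
move=> /=; apply: le_trans.
have m0 : 0 < (x + y) / (V + W) by rewrite divr_gt0// addr_gt0.
have lnm u : 0 < u -> ln (u / ((x + y) / (V + W))) =
    ln u - ln ((x + y) / (V + W)) by move=> u0; rewrite ln_div ?posrE.
by rewrite !lnm ?divr_gt0// /relent; lra.
Qed.
End Hellinger.

(** * A logarithmic Sobolev inequality on the line *)

Section Line.
Variables (R : realType) (v : nat -> R) (B : R).
Hypothesis v_gt0 : forall n, 0 < v n.
Hypothesis v_homo : forall n, v n <= v n.+1.
Hypothesis v_ratio : forall n, v n.+1 <= B * v n.
Hypothesis v_logconcave : forall n, v n * v n.+2 <= v n.+1 ^+ 2.

Let mass s t := \sum_(s <= n < t) v n.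

Let v_le m n : (m <= n)%N -> v m <= v n.
Proof. exact: (homo_leq (@lexx _ _) le_trans v_homo). Qed.

Let B_ge1 : 1 <= B.
Proof. by rewrite -(ler_pM2r (v_gt0 0)) mul1r (le_trans (v_homo 0)). Qed.

Let mass_ge0 s t : 0 <= mass s t.
Proof. by apply: sumr_ge0 => n _; exact: ltW. Qed.

Let massD s r t : (s <= r <= t)%N -> mass s t = mass s r + mass r t.
Proof. by move=> /andP[sr rt]; rewrite /mass (big_cat_nat sr rt). Qed.

Let mass_gt0 s t : (s < t)%N -> 0 < mass s t.
Proof.
by move=> st; rewrite /mass big_ltn// ltr_pwDl// mass_ge0.
Qed.

Let mass_le s t i : (t <= i.+1)%N -> mass s t <= (t - s)%:R * v i.
Proof.
move=> ti; rewrite mulr_natl -sumr_const_nat.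
by apply: ler_sum_nat => n /andP[_ nt]; apply: v_le; lia.
Qed.

Lemma prefix_mass_step s i : (s <= i)%N ->
  mass s i.+1 * v i.+1 <= mass s i.+2 * v i.
Proof.
move=> /subnK <-; elim: (i - s)%N => [|k IH].
  have -> : mass (0 + s) (0 + s).+2 = v s + v s.+1.
    by rewrite /mass !big_nat_recr//= big_geq ?add0r.
  rewrite add0n /mass big_nat1.
  by have := mulr_gt0 (v_gt0 s) (v_gt0 s); lra.
rewrite addSn; set j := (k + s)%N in IH *.
have sj : (s <= j)%N by rewrite leq_addl.
have E1 : mass s j.+2 = mass s j.+1 + v j.+1 by rewrite /mass big_nat_recr//; lia.
have E2 : mass s j.+3 = mass s j.+2 + v j.+2 by rewrite /mass big_nat_recr//; lia.
have h : mass s j.+1 * v j.+2 <= mass s j.+2 * v j.+1.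
  rewrite -(ler_pM2r (v_gt0 j)).
  apply: (@le_trans _ _ (mass s j.+1 * v j.+1 ^+ 2)).
    by rewrite -mulrA [v j.+2 * _]mulrC ler_wpM2l.
  rewrite expr2 mulrA [leRHS]mulrAC; apply: ler_wpM2r => //; exact: ltW.
rewrite E2 {1}E1; lra.
Qed.

(** For log-concave weights the prefix mass relative to the weight at its end
    grows with the end. The weight of an edge therefore controls the mass to
    its left that has to cross it. *)
Lemma prefix_mass_ratio s i j : (s <= i <= j)%N ->
  mass s i.+1 * v j <= mass s j.+1 * v i.
Proof.
move=> /andP[si /subnK <-]; elim: (j - i)%N => [//|k IH].
rewrite addSn -(ler_pM2r (v_gt0 (k + i))).
apply: (@le_trans _ _ (mass s (k + i).+1 * v i * v (k + i).+1)).
  by rewrite mulrAC; apply: ler_wpM2r => //; exact: ltW.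
rewrite mulrAC [leRHS]mulrAC; apply: ler_wpM2r; first exact: ltW.
by apply: prefix_mass_step; lia.
Qed.

(** Neither part is exponentially light, so the two-point inequality costs only
    ln (4 B). The cut is the last one that leaves a quarter of the mass on its
    right; moving it one step further would not, and the weight of that one
    step is at most B times the last weight on the left. *)
Lemma balanced_split s t : (s.+1 < t)%N ->
  exists r, [/\ (s < r < t)%N, mass s t <= 4 * B * mass s r
    & mass s t <= 4 * B * mass r t].
Proof.
move=> st; pose P r := (r < t)%N && (mass s t <= 4 * mass r t).
have Ps : P s.+1.
  rewrite /P st/= (@massD s s.+1); last by lia.
  have : mass s s.+1 <= mass s.+1 t.
    rewrite /mass big_nat1 big_ltn//.
    by rewrite (le_trans (v_homo s))// lerDl mass_ge0.
  by have := mass_ge0 s s.+1; lra.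
have Pt r : P r -> (r <= t)%N by move=> /andP[/ltnW].
have exP : exists r, P r by exists s.+1.
case: (ex_maxnP exP Pt) => r /andP[rt h] rmax.
have sr : (s < r)%N by exact: rmax.
exists r; split; first exact/andP.
  have hr : 4 * mass r.+1 t <= mass s t.
    have [E|rt1] := eqVneq r.+1 t.
      by rewrite E {1}/mass big_geq// mulr0 mass_ge0.
    rewrite leNgt; apply/negP => lt1.
    have /rmax : P r.+1 by rewrite /P (ltW lt1) andbT ltn_neqAle rt1.
    by rewrite ltnn.
  have vr : v r <= B * mass s r.
    case: r sr {h hr rmax rt} => // r sr.
    apply: (le_trans (v_ratio r)); rewrite ler_wpM2l//.
      exact: le_trans ler01 B_ge1.
    by rewrite /mass big_nat_recr//= lerDr mass_ge0.
  have : mass s t = mass s r + v r + mass r.+1 t.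
    rewrite (@massD s r.+1 t)//; last by lia.
    by rewrite {1}/mass big_nat_recr//; lia.
  have : mass s r <= B * mass s r by rewrite ler_peMl.
  by have := mass_ge0 s r; lra.
apply: (le_trans h); rewrite -mulrA ler_wpM2l// ler_peMl//.
Qed.

(** The function under study is [y]; [x] collects its weighted values. *)
Variable x : nat -> R.
Hypothesis x_gt0 : forall n, 0 < x n.
Let y n := x n / v n.
Let q i := hellinger (y i) (y i.+1).

Let y_gt0 n : 0 < y n. Proof. exact: divr_gt0. Qed.
Let q_ge0 n : 0 <= q n. Proof. exact: hellinger_ge0. Qed.
Let vy n : v n * y n = x n.
Proof. by rewrite /y mulrCA divff ?mulr1// gt_eqF. Qed.

Let exchange_prefix s r :
  \sum_(s <= n < r) v n * \sum_(n <= i < r) q i =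
  \sum_(s <= i < r) mass s i.+1 * q i.
Proof.
elim: r => [|r IH]; first by rewrite !big_geq.
have [sr|rs] := leqP s r; last by rewrite !big_geq.
rewrite [RHS]big_nat_recr//= -IH mulr_suml [in RHS]big_nat_recr//= addrA.
rewrite -big_split/= big_nat_recr//= big_nat1; congr (_ + _).
apply: eq_big_nat => n /andP[_ nr].
by rewrite big_nat_recr ?mulrDr// ltnW.
Qed.

(** Couple the two blocks independently and join each pair of points by a path.
    Apart from the total length, an edge on one side of the cut is charged the
    length of the other side: on the left because the mass pushed through it is
    bounded by [prefix_mass_ratio], on the right because the weights do not
    decrease. This asymmetry makes the charges of successive cuts add up to a
    square. *)
Lemma cross_hellinger s r t : (s < r < t)%N ->
  hellinger (mass r t * \sum_(s <= n < r) x n) (mass s r * \sum_(r <= n < t) x n) <=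
  (t - s)%:R * mass s t *
    ((t - r)%:R * \sum_(s <= i < r) v i * q i +
     (r - s)%:R * \sum_(r <= i < t.-1) v i * q i).
Proof.
move=> /andP[sr rt].
have N0 : (0 : R) <= (t - s)%:R by rewrite ler0n.
have -> : mass r t * \sum_(s <= n < r) x n =
    \sum_(s <= n < r) \sum_(r <= m < t) v n * v m * y n.
  rewrite mulrC mulr_suml; apply: eq_bigr => n _.
  rewrite mulr_sumr; apply: eq_bigr => m _.
  by rewrite -(vy n); ring.
have -> : mass s r * \sum_(r <= n < t) x n =
    \sum_(s <= n < r) \sum_(r <= m < t) v n * v m * y m.
  rewrite mulr_suml; apply: eq_bigr => n _.
  rewrite mulr_sumr; apply: eq_bigr => m _.
  by rewrite -(vy m); ring.
have vvy n m k : 0 <= v n * v m * y k by apply: mulr_ge0; [apply: mulr_ge0|]; apply: ltW.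
apply: le_trans (hellinger_sum _ _ _) _ => [n|n|]; try by apply: sumr_ge0 => m _.
set P := \sum_(r <= i < t.-1) q i.
have P0 : 0 <= P by apply: sumr_ge0.
have step n : (s <= n < r)%N ->
    hellinger (\sum_(r <= m < t) v n * v m * y n) (\sum_(r <= m < t) v n * v m * y m) <=
    (t - s)%:R * mass r t * (v n * (\sum_(n <= i < r) q i + P)).
  move=> /andP[sn nr].
  apply: le_trans (hellinger_sum _ _ _) _ => // .
  have -> : (t - s)%:R * mass r t * (v n * (\sum_(n <= i < r) q i + P)) =
    \sum_(r <= m < t) v n * v m * ((t - s)%:R * (\sum_(n <= i < r) q i + P)).
    by rewrite -mulr_suml -mulr_sumr -/(mass r t); ring.
  apply: ler_sum_nat => m /andP[rm mt].
  rewrite hellingerZ; last by apply: mulr_ge0; exact: ltW.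
  apply: ler_wpM2l; first by apply: mulr_ge0; exact: ltW.
  have := hellinger_path y n (m - n); rewrite subnKC; last by lia.
  move=> /le_trans; apply; apply: ler_pM => //.
  - by apply: sumr_ge0 => i _; exact: q_ge0.
  - by rewrite ler_nat; lia.
  rewrite (big_cat_nat (ltnW nr) rm)/= lerD2l /P.
  have mt' : (m <= t.-1)%N by lia.
  by rewrite (big_cat_nat rm mt')/= lerDl sumr_ge0.
apply: le_trans (ler_sum_nat step) _.
rewrite -mulr_sumr -!mulrA; apply: ler_wpM2l => //.
under eq_bigr do rewrite mulrDr.
rewrite big_split/= exchange_prefix -mulr_suml -/(mass s r) !mulrDr.
apply: lerD.
  rewrite !mulr_sumr; apply: ler_sum_nat => i /andP[si ir].
  have := q_ge0 i; move: (q i) => qi qi0.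
  rewrite !mulrA; apply: ler_wpM2r => //.
  have vt0 := v_gt0 t.-1.
  have h1 : mass r t <= (t - r)%:R * v t.-1 by apply: mass_le; lia.
  have h2 : mass s i.+1 * v t.-1 <= mass s t * v i.
    have := @prefix_mass_ratio s i t.-1; rewrite prednK; last by lia.
    by apply; lia.
  apply: (@le_trans _ _ ((t - r)%:R * v t.-1 * mass s i.+1)).
    exact: ler_wpM2r.
  have -> : mass s t * (t - r)%:R * v i = (t - r)%:R * (mass s t * v i) by ring.
  by rewrite -mulrA; apply: ler_wpM2l; rewrite ?ler0n// mulrC.
rewrite mulrA /P !mulr_sumr; apply: ler_sum_nat => i /andP[ri it].
have := q_ge0 i; move: (q i) => qi qi0.
rewrite !mulrA; apply: ler_wpM2r => //.
have h1 : mass s r <= (r - s)%:R * v i by apply: mass_le; lia.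
have h2 : mass r t <= mass s t by rewrite (@massD s r t) ?lerDr//; lia.
by rewrite -mulrA; exact: ler_pM.
Qed.

(** Cut recursively with [balanced_split]. For parts of lengths a and b a left
    edge costs a^2 + (a + b) b and a right edge b^2 + (a + b) a, both at most
    (a + b)^2, so the constant does not grow with the depth of the recursion. *)
Lemma line_log_sobolev s t : (s < t)%N ->
  \sum_(s <= n < t) relent (x n) (v n) -
    relent (\sum_(s <= n < t) x n) (mass s t) <=
  16 * (1 + ln (4 * B)) * (t - s)%:R ^+ 2 * \sum_(s <= i < t.-1) v i * q i.
Proof.
have L0 : 0 <= 16 * (1 + ln (4 * B)).
  by rewrite mulr_ge0// addr_ge0// ln_ge0//; have := B_ge1; lra.
have [k] := ubnP (t - s)%N; elim: k s t => [//|k IH] s t tsk st.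
have e0 a b : 0 <= \sum_(a <= i < b) v i * q i.
  by apply: sumr_ge0 => i _; rewrite mulr_ge0 // ltW.
have [E|st1] := eqVneq t s.+1.
  rewrite E /mass !big_nat1 subrr.
  by apply: mulr_ge0 => //; apply: mulr_ge0 => //; exact: sqr_ge0.
have {}st1 : (s.+1 < t)%N by lia.
have [r [srt m1 m2]] := balanced_split st1.
have /andP[sr rt] := srt.
have {}IH a b : (b - a < t - s)%N -> _ := fun h => IH a b (leq_trans h tsk).
have IH1 := IH s r (ltn_sub2r st rt) sr.
have IH2 := IH r t (ltn_sub2l st sr) rt.
have Vst : mass s t = mass s r + mass r t by apply: massD; lia.
have sum0 a b : (a < b)%N -> 0 < \sum_(a <= n < b) x n.
  move=> ab; rewrite big_ltn// ltr_pwDl// sumr_ge0// => i _; exact: ltW.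
rewrite Vst in m1 m2.
have T := two_point (sum0 _ _ sr) (sum0 _ _ rt) (mass_gt0 sr) (mass_gt0 rt) m1 m2.
rewrite -Vst in T.
rewrite !(big_cat_nat (ltnW sr) (ltnW rt))/=.
have rt' : (r <= t.-1)%N by rewrite -ltnS (ltn_predK rt).
rewrite (big_cat_nat (ltnW sr) rt')/=.
have C := cross_hellinger srt.
have V0 := mass_gt0 st.
have {}C : hellinger (mass r t * \sum_(s <= n < r) x n)
      (mass s r * \sum_(r <= n < t) x n) / mass s t <=
    (t - s)%:R * ((t - r)%:R * \sum_(s <= i < r) v i * q i +
      (r - s)%:R * \sum_(r <= i < t.-1) v i * q i).
  by rewrite ler_pdivrMr// mulrAC.
have {}T := le_trans T (ler_wpM2l L0 C).
have h1 : \sum_(s <= i < r.-1) v i * q i <= \sum_(s <= i < r) v i * q i.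
  case: r sr {T C IH1 IH2 m1 m2 srt rt rt' Vst} => // r sr.
  by rewrite [leRHS]big_nat_recr//= lerDl mulr_ge0// ltW.
have {}IH1 := le_trans IH1 (ler_wpM2l (mulr_ge0 L0 (sqr_ge0 _)) h1).
have a0 : (0 : R) <= (r - s)%:R by rewrite ler0n.
have b0 : (0 : R) <= (t - r)%:R by rewrite ler0n.
have Nab : (t - s)%:R = (r - s)%:R + (t - r)%:R :> R.
  by rewrite -natrD addnC addnBA ?subnK// ltnW.
rewrite Nab in T *.
have slack := mulr_ge0 L0 (mulr_ge0 (mulr_ge0 a0 b0) (addr_ge0 (e0 s r) (e0 r t.-1))).
lra.
Qed.
End Line.

(** * Compositions and jumps *)

(** In the recursion [n] is the number of particles that remain for the last
    sites, the first one holding [K - n]. The number of compositions is then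
    the weight of [n], and it does not decrease with [n]. *)
Fixpoint comps (L K : nat) : seq (seq nat) :=
  if L is L'.+1 then
    [seq (K - n)%N :: s | n <- iota 0 K.+1, s <- comps L' n]
  else if K == 0%N then [:: [::]] else [::].

(** Only jumps from a site to a later one are listed: each unordered pair of
    neighbouring configurations appears once. The second list consists of the
    jumps out of the first site. *)
Fixpoint moves (L K : nat) : seq (seq nat * seq nat) :=
  if L is L'.+1 then
    [seq ((K - n)%N :: p.1, (K - n)%N :: p.2) | n <- iota 0 K.+1, p <- moves L' n]
    ++ [seq ((K - n)%N :: p.1, (K - n.+1)%N :: incr_nth p.1 p.2) |
         n <- iota 0 K, p <- [seq (s, j) | s <- comps L' n, j <- iota 0 L']]
  else [::].

Lemma compsS L K : comps L.+1 K =
  [seq (K - n)%N :: s | n <- iota 0 K.+1, s <- comps L n].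
Proof. by []. Qed.

Lemma movesS L K : moves L.+1 K =
  [seq ((K - n)%N :: p.1, (K - n)%N :: p.2) | n <- iota 0 K.+1, p <- moves L n]
    ++ [seq ((K - n)%N :: p.1, (K - n.+1)%N :: incr_nth p.1 p.2) |
         n <- iota 0 K, p <- [seq (s, j) | s <- comps L n, j <- iota 0 L]].
Proof. by []. Qed.

Lemma mem_comps L K s : (s \in comps L K) = (size s == L) && (sumn s == K).
Proof.
elim: L K s => [|L IH] K s; last rewrite compsS.
  by case: s => [|a s]; case: K.
apply/allpairsPdep/idP => [[n [t [nK tL ->]]]|].
  move: nK; rewrite mem_iota/= => nK; move: tL; rewrite IH => /andP[/eqP <- /eqP ->].
  by rewrite eqxx/=; apply/eqP; lia.
case: s => [//|a s] /= /andP[sL /eqP sK].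
exists (sumn s), s; split; first by rewrite -[_ :: _]/(iota 0 K.+1) mem_iota; lia.
  by rewrite IH -eqSS sL /=.
by congr cons; lia.
Qed.

Lemma comps_uniq L K : uniq (comps L K).
Proof.
elim: L K => [|L IH] K; last rewrite compsS; first by case: K.
apply: allpairs_uniq_dep => [|n _|]; [exact: iota_uniq|exact: IH|].
move=> _ _ /allpairsPdep[n [s [_ sn ->]]] /allpairsPdep[m [t [_ tm ->]]] /= [_ E].
move: sn tm; rewrite E !mem_comps => /andP[_ /eqP <-] /andP[_ /eqP nm].
by rewrite nm.
Qed.

(** * Polya urn identities *)

Section Urn.
Variable R : realType.
Implicit Type F : seq nat -> R.

Lemma sum_comps L K F : \sum_(s <- comps L.+1 K) F s =
  \sum_(0 <= n < K.+1) \sum_(s <- comps L n) F ((K - n)%N :: s).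
Proof. by rewrite compsS big_allpairs_dep. Qed.

Lemma urn_site L K j F : (j < L)%N ->
  \sum_(s <- comps L K) (nth 0%N s j).+1%:R * F (incr_nth s j) =
  \sum_(s <- comps L K.+1) (nth 0%N s j)%:R * F s.
Proof.
elim: L K j F => [//|L IH] K [|j] F jL; rewrite !sum_comps.
  rewrite [RHS]big_nat_recr//= subnn [X in _ = _ + X]big1_seq ?addr0.
    by apply: eq_big_nat => n nK; rewrite subSn; last by lia.
  by move=> s _; rewrite mul0r.
rewrite [RHS]big_nat_recl//= [X in _ = X + _]big1_seq ?add0r.
  apply: eq_big_nat => n nK.
  by rewrite (IH n j (fun s => F ((K - n)%N :: s))).
move=> s; rewrite mem_comps => /andP[_ /andP[_ /eqP s0]].
have -> : nth 0%N s j = 0%N; last by rewrite mul0r.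
move: s0; clear; elim: s j => [|a s IH] [|j] //=; first by lia.
by move=> h; apply: IH; lia.
Qed.

Lemma nth_comps_le L K s j : s \in comps L K -> (nth 0%N s j <= K)%N.
Proof.
rewrite mem_comps => /andP[_ /eqP <-]; clear.
elim: s j => [|a s IH] [|j] //=; first by lia.
by apply: leq_trans (IH j) _; lia.
Qed.

Lemma sum_nth (s : seq nat) L : size s = L ->
  \sum_(0 <= j < L) (nth 0%N s j).+1%:R = (sumn s + L)%:R :> R.
Proof.
move=> <-; elim: s => [|a s IH]; first by rewrite big_geq.
by rewrite big_nat_recl//= IH -natrD; congr _%:R; lia.
Qed.

(** Adding a particle to a uniform composition, at site j with probability
    proportional to s_j + 1, yields a uniform composition: a coupling of the
    uniform measures for K and K + 1 particles along single additions. *)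
Lemma urn L K F :
  \sum_(s <- comps L K) \sum_(0 <= j < L) (nth 0%N s j).+1%:R * F (incr_nth s j) =
  K.+1%:R * \sum_(s <- comps L K.+1) F s.
Proof.
rewrite exchange_big/=.
under eq_big_nat => j jL do rewrite urn_site//.
rewrite exchange_big/= mulr_sumr; apply: eq_big_seq => s.
rewrite mem_comps => /andP[/eqP sL /eqP sK].
rewrite -mulr_suml -sK; congr (_ * _).
rewrite -natr_sum; congr _%:R; rewrite -sL; clear.
by elim: s => [|a s IH] /=; [rewrite big_geq|rewrite big_nat_recl//= IH].
Qed.

(** This recursion gives everything that the line inequality asks of the weights,
    without a closed formula for them. *)
Lemma urn_size L K :
  (K + L)%:R * (size (comps L K))%:R = K.+1%:R * (size (comps L K.+1))%:R :> R.
Proof.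
have := urn L K (fun=> 1).
rewrite (eq_big_seq (fun=> (K + L)%:R)) => [|s].
  by rewrite !big_const_seq !count_predT !iter_addr_0 -[X in X = _]mulr_natr.
rewrite mem_comps => /andP[/eqP sL /eqP sK].
by under eq_bigr do rewrite mulr1; rewrite sum_nth// sK.
Qed.
End Urn.

(** * The inequality on compositions *)

Section Compositions.
Variable R : realType.
Implicit Types f g : seq nat -> R.

Let vol L K : R := (size (comps L K))%:R.

Let volE L K : vol L K = \sum_(s <- comps L K) 1.
Proof. by rewrite big_const_seq count_predT iter_addr_0. Qed.

Let vol_gt0 L K : 0 < vol L.+1 K.
Proof.
rewrite ltr0n -has_predT; apply/hasP; exists (K :: nseq L 0%N) => //.
by rewrite mem_comps /= size_nseq sumn_nseq mul0n addn0 !eqxx.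
Qed.

Let volS L K : vol L.+1 K = \sum_(0 <= n < K.+1) vol L n.
Proof. by rewrite volE sum_comps; apply: eq_bigr => n _; rewrite volE. Qed.

Let vol_homo L n : vol L.+1 n <= vol L.+1 n.+1.
Proof.
rewrite -(ler_pM2l (ltr0Sn R n)) -urn_size ler_wpM2r ?(ltW (vol_gt0 _ _))//.
by rewrite ler_nat; lia.
Qed.

Let vol_ratio L n : vol L.+1 n.+1 <= L.+1%:R * vol L.+1 n.
Proof.
rewrite -(ler_pM2l (ltr0Sn R n)) -urn_size mulrA.
rewrite ler_wpM2r ?(ltW (vol_gt0 _ _))// -natrM ler_nat; lia.
Qed.

Let vol_logconcave L n : vol L.+1 n * vol L.+1 n.+2 <= vol L.+1 n.+1 ^+ 2.
Proof.
have := urn_size R L.+1 n; have := urn_size R L.+1 n.+1; rewrite -!/(vol _ _).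
have := vol_gt0 L n.+1; have := ler0n R n; have := ler0n R L.
rewrite !natrD -!natr1.
move: (n%:R) (L%:R) (vol _ n) (vol _ n.+1) (vol _ n.+2) => k l a b c l0 k0 b0 E2 E1.
have h : 0 < (k + (l + 1)) * (k + 1 + 1) by rewrite mulr_gt0//; lra.
rewrite -(ler_pM2l h).
have -> : (k + (l + 1)) * (k + 1 + 1) * (a * c) =
  ((k + (l + 1)) * a) * ((k + 1 + 1) * c) by ring.
rewrite E1 -E2 -subr_ge0.
have -> : (k + (l + 1)) * (k + 1 + 1) * b ^+ 2 -
    (k + 1) * b * ((k + 1 + (l + 1)) * b) = l * b ^+ 2 by ring.
by rewrite mulr_ge0// sqr_ge0.
Qed.

(** Moving one particle out of the first site changes the number left for the
    others from n to n + 1. By the urn coupling, the increment of the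
    conditional averages is dominated by genuine jumps, each with a probability
    at most 1. *)
Lemma coupling L n f g : (forall s, 0 < f s) -> (forall s, 0 < g s) ->
  vol L.+1 n * hellinger ((\sum_(s <- comps L.+1 n) f s) / vol L.+1 n)
    ((\sum_(s <- comps L.+1 n.+1) g s) / vol L.+1 n.+1) <=
  \sum_(s <- comps L.+1 n) \sum_(0 <= j < L.+1) hellinger (f s) (g (incr_nth s j)).
Proof.
move=> f0 g0; have v0 := vol_gt0 L n; have v1 := vol_gt0 L n.+1.
rewrite -hellingerZ; last exact: ltW.
rewrite mulrCA divff ?gt_eqF// mulr1.
pose w (s : seq nat) j : R := (nth 0%N s j).+1%:R / (n + L.+1)%:R.
have w0 s j : 0 <= w s j by rewrite divr_ge0.
have nL : (n + L.+1)%:R != 0 :> R by rewrite pnatr_eq0; lia.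
have -> : \sum_(s <- comps L.+1 n) f s =
    \sum_(s <- comps L.+1 n) \sum_(0 <= j < L.+1) w s j * f s.
  apply: eq_big_seq => s; rewrite mem_comps => /andP[/eqP sL /eqP sn].
  by rewrite -mulr_suml -mulr_suml sum_nth// sn divff// mul1r.
have -> : vol L.+1 n * ((\sum_(s <- comps L.+1 n.+1) g s) / vol L.+1 n.+1) =
    \sum_(s <- comps L.+1 n) \sum_(0 <= j < L.+1) w s j * g (incr_nth s j).
  have -> : \sum_(s <- comps L.+1 n) \sum_(0 <= j < L.+1) w s j * g (incr_nth s j)
      = (\sum_(s <- comps L.+1 n) \sum_(0 <= j < L.+1)
          (nth 0%N s j).+1%:R * g (incr_nth s j)) / (n + L.+1)%:R.
    rewrite mulr_suml; apply: eq_bigr => s _; rewrite mulr_suml.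
    by apply: eq_bigr => j _; rewrite /w mulrAC.
  rewrite urn; have := urn_size R L.+1 n; rewrite -!/(vol _ _) => E.
  have v1' : vol L.+1 n.+1 != 0 by rewrite gt_eqF.
  have -> : vol L.+1 n = n.+1%:R * vol L.+1 n.+1 / (n + L.+1)%:R.
    by rewrite -E [_ * vol _ _]mulrC mulfK.
  by rewrite [LHS]mulrAC; congr (_ / _); rewrite -mulrA [_ * (_ / _)]mulrCA divff ?mulr1.
apply: le_trans (hellinger_sum _ _ _) _ => [s|s|].
- by apply: sumr_ge0 => j _; apply: mulr_ge0 => //; exact: ltW.
- by apply: sumr_ge0 => j _; apply: mulr_ge0 => //; exact: ltW.
rewrite [leLHS]big_seq [leRHS]big_seq; apply: ler_sum => s sn.
apply: le_trans (hellinger_sum _ _ _) _ => [j|j|].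
- by apply: mulr_ge0 => //; exact: ltW.
- by apply: mulr_ge0 => //; exact: ltW.
apply: ler_sum => j _; rewrite hellingerZ//.
rewrite ler_piMl ?hellinger_ge0// ler_pdivrMr ?ltr0n; last by lia.
by rewrite mul1r ler_nat; have := nth_comps_le j sn; lia.
Qed.

Lemma sum_moves L K (F : seq nat * seq nat -> R) :
  \sum_(p <- moves L.+1 K) F p =
  \sum_(0 <= n < K.+1) \sum_(p <- moves L n)
     F ((K - n)%N :: p.1, (K - n)%N :: p.2) +
  \sum_(0 <= n < K) \sum_(s <- comps L n) \sum_(0 <= j < L)
     F ((K - n)%N :: s, (K - n.+1)%N :: incr_nth s j).
Proof.
rewrite movesS big_cat !big_allpairs_dep/= /index_iota !subn0; congr (_ + _).
by apply: eq_bigr => n _; rewrite big_allpairs_dep.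
Qed.

(** Induction on the number of sites, by the chain rule for entropy with respect
    to the occupation of the first site: the conditional entropies use jumps
    between the other sites, the entropy of the conditional averages uses jumps
    out of the first site. The two sets of jumps are disjoint, so constants do
    not accumulate. *)
Lemma comps_log_sobolev m L K f : (L <= m)%N -> (0 < m)%N ->
  (forall s, 0 < f s) ->
  \sum_(s <- comps L.+1 K) relent (f s) 1 -
    relent (\sum_(s <- comps L.+1 K) f s) (vol L.+1 K) <=
  16 * (1 + ln (4 * m%:R)) * K.+1%:R ^+ 2 *
    \sum_(p <- moves L.+1 K) hellinger (f p.1) (f p.2).
Proof.
move=> Lm m0.
have A0 : 0 <= 16 * (1 + ln (4 * m%:R)) :> R.
  rewrite mulr_ge0// addr_ge0// ln_ge0//.
  by rewrite -natrM ler1n; lia.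
elim: L K f Lm => [|L IH] K f Lm f0.
  have c1 F : \sum_(s <- comps 1 K) F s = F [:: K] :> R.
    rewrite sum_comps big_nat_recl//= [X in _ + X]big1 ?addr0 => [|n _].
      by rewrite big_seq1 subn0.
    by rewrite big_nil.
  rewrite volE !c1 subrr; apply: mulr_ge0; last first.
    by apply: sumr_ge0 => p _; exact: hellinger_ge0.
  by apply: mulr_ge0 => //; exact: sqr_ge0.
(* [F n] is f on the fibre where [n] particles are outside the first site. *)
pose F n s := f ((K - n)%N :: s).
pose x n := \sum_(s <- comps L.+1 n) F n s.
have x_gt0 n : 0 < x n.
  have := vol_gt0 L n; rewrite /vol ltr0n /x.
  case: (comps L.+1 n) => // s r _; rewrite big_cons ltr_pwDl//; first exact: f0.
  by apply: sumr_ge0 => t _; apply: ltW; exact: f0.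
have v_ratio n : vol L.+1 n.+1 <= m%:R * vol L.+1 n.
  apply: le_trans (vol_ratio L n) _; apply: ler_wpM2r; first exact: ltW.
  by rewrite ler_nat.
have line := line_log_sobolev (vol_gt0 L) (vol_homo L) v_ratio
  (vol_logconcave L) x_gt0 (ltn0Sn K).
rewrite !sum_comps volS sum_moves.
rewrite -/(x _) subn0 /= in line *.
have inner : \sum_(0 <= n < K.+1) \sum_(s <- comps L.+1 n) relent (F n s) 1 -
    \sum_(0 <= n < K.+1) relent (x n) (vol L.+1 n) <=
    16 * (1 + ln (4 * m%:R)) * K.+1%:R ^+ 2 *
    \sum_(0 <= n < K.+1) \sum_(p <- moves L.+1 n) hellinger (F n p.1) (F n p.2).
  rewrite -sumrB mulr_sumr; apply: ler_sum_nat => n /andP[_ nK].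
  apply: le_trans (IH n (F n) (ltnW Lm) _) _ => [s|]; first exact: f0.
  apply: ler_wpM2r; first by apply: sumr_ge0 => p _; exact: hellinger_ge0.
  by apply: ler_wpM2l => //; rewrite ler_pXn2r ?nnegrE// ler_nat.
have outer : \sum_(0 <= n < K) vol L.+1 n *
      hellinger (x n / vol L.+1 n) (x n.+1 / vol L.+1 n.+1) <=
    \sum_(0 <= n < K) \sum_(s <- comps L.+1 n) \sum_(0 <= j < L.+1)
      hellinger (F n s) (F n.+1 (incr_nth s j)).
  by apply: ler_sum => n _; apply: coupling => s; exact: f0.
have {}outer := ler_wpM2l (mulr_ge0 A0 (sqr_ge0 K.+1%:R)) outer.
rewrite mulrDr; move: line inner outer; rewrite /F; lra.
Qed.
End Compositions.

(** * Transfer to the zero-range process *)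

Definition single_jump (s t : seq nat) i j :=
  forall k, nth 0%N t k = (nth 0%N s k - (k == i) + (k == j))%N.

Lemma sumn_incr_nth (s : seq nat) j : sumn (incr_nth s j) = (sumn s).+1.
Proof.
elim: s j => [|a s IH] [|j] //=; last by rewrite IH addnS.
by rewrite sumn_ncons.
Qed.

Lemma mem_moves L K p : p \in moves L K ->
  [/\ p.1 \in comps L K, p.2 \in comps L K &
    exists i j, [/\ (i < L)%N, (j < L)%N, i != j, (0 < nth 0%N p.1 i)%N
      & single_jump p.1 p.2 i j]].
Proof.
elim: L K p => [//|L IH] K p; rewrite movesS mem_cat => /orP[].
  case/allpairsPdep => n [q [nK /IH [q1 q2 [i [j [iL jL ij i0 h]]]] ->]].
  split; [by rewrite compsS; apply/allpairsPdep; exists n, q.1|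
          by rewrite compsS; apply/allpairsPdep; exists n, q.2|].
  exists i.+1, j.+1; split=> // -[|k] /=; first by rewrite subn0 addn0.
  exact: h.
case/allpairsPdep => n [q [nK /allpairsP[[s j] [sn jL ->]] ->]].
rewrite /fst in sn; rewrite /snd in jL.
have nltK : (n < K)%N by move: nK; rewrite mem_iota.
have jltL : (j < L)%N by move: jL; rewrite mem_iota.
move: (sn); rewrite mem_comps => /andP[/eqP sL /eqP sK].
split.
- by rewrite mem_comps /= sL sK eqxx/=; apply/eqP; lia.
- rewrite mem_comps/= size_incr_nth sL jltL eqxx/= sumn_incr_nth sK.
  by apply/eqP; lia.
exists 0%N, j.+1; split => //=; first by lia.
case=> [|k] /=; first by rewrite addn0; lia.
by rewrite nth_incr_nth eqSS subn0 addnC eq_sym.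
Qed.

Lemma moves_uniq L K : uniq (moves L K).
Proof.
elim: L K => [//|L IH] K; rewrite movesS cat_uniq; apply/and3P; split.
- apply: allpairs_uniq_dep => [|n _|]; [exact: iota_uniq|exact: IH|].
  move=> _ _ /allpairsPdep[n [p [_ pn ->]]] /allpairsPdep[m [q [_ qm ->]]] /=.
  move=> [_ E1 _ E2].
  have Epq : p = q by case: p q E1 E2 {pn qm} => [? ?] [? ?] /= -> ->.
  have [+ _ _] := mem_moves pn; have [+ _ _] := mem_moves qm.
  rewrite Epq !mem_comps => /andP[_ /eqP <-] /andP[_ /eqP <-].
  by [].
- apply/hasPn => _ /allpairsPdep[n [q [nK _ ->]]].
  apply/negP => /allpairsPdep[m [p [mK _ [E1 _ E2 _]]]].
  by move: nK; rewrite mem_iota => nK; lia.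
apply: allpairs_uniq_dep => [|n _|]; first exact: iota_uniq.
  apply: allpairs_uniq => [||[? ?] [? ?]]; [exact: comps_uniq|exact: iota_uniq|by []].
move=> p1 p2 /allpairsPdep[n [q1 [_ /allpairsP[[s i] /= [sn _ ->]] ->]]].
move=> /allpairsPdep[m [q2 [_ /allpairsP[[t j] /= [tm _ ->]] ->]]] /=.
move=> [_ Est _ /(congr1 (nth 0%N ^~ i))].
move: sn tm; rewrite -Est !mem_comps => /andP[_ /eqP <-] /andP[_ /eqP <-].
by rewrite !nth_incr_nth eqxx => /eqP; rewrite eqn_add2r; case: (j =P i) => [->|].
Qed.

Section Configurations.
Variables (K L : nat).

Definition occs (eta : config K L) : seq nat := [seq occ eta i | i <- enum 'I_L].

Lemma nth_occs eta (i : 'I_L) : nth 0%N (occs eta) i = occ eta i.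
Proof. by rewrite (nth_map i) ?size_enum_ord// nth_ord_enum. Qed.

Lemma occs_inj : injective occs.
Proof.
move=> x y E; apply: val_inj; apply/ffunP => i; apply: val_inj.
by rewrite -[LHS]/(occ x i) -nth_occs E nth_occs.
Qed.

Lemma occs_comps eta : occs eta \in comps L K.
Proof.
rewrite mem_comps size_map size_enum_ord eqxx/= sumnE big_map big_enum/=.
exact: (valP eta).
Qed.

Lemma comps_occs s : s \in comps L K -> exists eta, s = occs eta.
Proof.
rewrite mem_comps => /andP[/eqP sL sK].
have sle i : (nth 0%N s i < K.+1)%N.
  by rewrite ltnS; apply: (@nth_comps_le L); rewrite mem_comps sL eqxx.
pose e : {ffun 'I_L -> 'I_K.+1} := [ffun i : 'I_L => Ordinal (sle i)].
have es : (\sum_(i < L) e i)%N == K.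
  apply/eqP; rewrite -[RHS](eqP sK) sumnE (big_nth 0%N) sL big_mkord.
  by apply: eq_bigr => i _; rewrite ffunE.
exists (Sub e es); apply: (@eq_from_nth _ 0%N).
  by rewrite size_map size_enum_ord.
move=> i; rewrite sL => iL.
by rewrite -[i]/(val (Ordinal iL)) nth_occs /occ /= ffunE.
Qed.

Lemma perm_occs : perm_eq [seq occs eta | eta <- enum {: config K L}] (comps L K).
Proof.
apply: uniq_perm; last move=> s.
- by rewrite (map_inj_uniq occs_inj) enum_uniq.
- exact: comps_uniq.
apply/mapP/idP => [[eta _ ->]|/comps_occs[eta ->]]; first exact: occs_comps.
by exists eta; rewrite ?mem_enum.
Qed.

Lemma sum_config (R : realType) (F : seq nat -> R) :
  \sum_(eta : config K L) F (occs eta) = \sum_(s <- comps L K) F s.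
Proof. by rewrite -(perm_big _ perm_occs)/= big_map big_enum. Qed.

Lemma zrp_rate_ge0 (R : realType) (x y : config K L) : 0 <= zrp_rate R x y.
Proof. by rewrite /zrp_rate; case: ifP => // _; rewrite invr_ge0. Qed.

Lemma zrp_rate_moves (R : realType) (x y : config K L) :
  (occs x, occs y) \in moves L K -> zrp_rate R x y = L%:R^-1.
Proof.
move=> /mem_moves[_ _ [i [j [iL jL ij i0 h]]]]; rewrite /zrp_rate ifT//.
apply/existsP; exists (Ordinal iL); apply/existsP; exists (Ordinal jL).
rewrite -nth_occs i0 -val_eqE ij /=; apply/forallP => k.
by rewrite /move -!nth_occs h.
Qed.

(** The factor [L] undoes the jump rate 1/L. *)
Lemma sum_moves_le (R : realType) (F : seq nat * seq nat -> R) :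
  (0 < L)%N -> (forall p, 0 <= F p) ->
  \sum_(p <- moves L K) F p <=
  L%:R * \sum_x \sum_y F (occs x, occs y) * zrp_rate R x y.
Proof.
move=> L0 F0.
pose o (z : config K L * config K L) := (occs z.1, occs z.2).
have oinj : injective o by move=> [x1 y1] [x2 y2] [/occs_inj -> /occs_inj ->].
have P : perm_eq (moves L K)
    [seq p <- [seq o z | z <- enum {: config K L * config K L}] | p \in moves L K].
  apply: uniq_perm => [||p]; first exact: moves_uniq.
    by rewrite filter_uniq// (map_inj_uniq oinj) enum_uniq.
  rewrite mem_filter; case: (boolP (p \in moves L K)) => //= /mem_moves[+ + _].
  case: p => s t /= /comps_occs[x ->] /comps_occs[y ->].
  by apply/esym/mapP; exists (x, y); rewrite ?mem_enum.
rewrite (perm_big _ P)/= big_filter big_map big_enum_cond/=.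
rewrite pair_big/= mulr_sumr big_mkcond/=; apply: ler_sum => -[x y] _ /=.
case: ifP => [/zrp_rate_moves ->|_].
  by rewrite mulrCA divff ?mulr1// pnatr_eq0; lia.
by rewrite !mulr_ge0// zrp_rate_ge0.
Qed.
End Configurations.

Theorem theorem7p2 (R : realType) :
  exists2 c : R, 0 < c &
    forall K L : nat, (1 <= K)%N -> (2 <= L)%N ->
      MLSI (@zrp_rate R K L) (@zrp_measure R K L)
        (c / (K%:R ^+ 2 * L%:R * ln L%:R)).
Proof.
(* 1280 = 2 * 2 * 80 * 4: the factors 2 come from 2 lambda and from the 1/2 in
   the Dirichlet form, 80 bounds 16 (1 + ln (4 L)) / ln L, and 4 bounds
   (K + 1)^2 / K^2. *)
exists (1280^-1); first by rewrite invr_gt0.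
move=> K L K1 L2 rho rho0 rho1.
have L0 : (0 < L)%N by lia.
set N : R := #|{: config K L}|%:R.
have N0 : N != 0.
  apply/negP => /eqP N0; move/eqP: rho1; rewrite big1 => [|x _].
    by rewrite eq_sym oner_eq0.
  by rewrite /zrp_measure -/N N0 invr0 mulr0.
have Ngt0 : 0 < N by rewrite lt_def N0 ler0n.
have sumrho : \sum_x rho x = N.
  by apply: (divIf N0); rewrite divff// mulr_suml.
(* The value 1 outside the image of [occs] only serves to keep f positive. *)
pose f s := if [pick x | occs x == s] is Some x then rho x else 1.
have f_gt0 s : 0 < f s by rewrite /f; case: pickP.
have fE x : f (@occs K L x) = rho x.
  rewrite /f; case: pickP => [y /eqP/occs_inj -> //|/(_ x)].
  by rewrite eqxx.
have sizeN : (size (comps L K))%:R = N.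
  by rewrite -(perm_size (perm_occs K L)) size_map -cardE.
case: L L0 L2 @N N0 Ngt0 rho rho0 rho1 sumrho @f f_gt0 fE sizeN =>
  // L _ L2 N N0 Ngt0 rho rho0 rho1 sumrho f f_gt0 fE sizeN.
have := @comps_log_sobolev R L.+1 L K f (leqnSn L) (ltn0Sn L) f_gt0.
rewrite -!sum_config sizeN.
under eq_bigr do rewrite fE /relent divr1.
under [X in relent X _]eq_bigr do rewrite fE.
rewrite sumrho /relent divff// ln1 mulr0 subr0.
set H := \sum_x _; set S := \sum_(p <- _) _ => HS.
set D := dirichlet _ _ _ _.
have lnL : 2^-1 <= ln L.+1%:R :> R.
  apply: (@le_trans _ _ (ln 2)).
    have := @ln_leB1 R 2^-1; rewrite lnV ?posrE//.
    have h2 : (0 : R) < 2^-1 by rewrite invr_gt0.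
    by move=> /(_ h2); lra.
  by rewrite ler_ln ?posrE// ler_nat.
have A5 : 16 * (1 + ln (4 * L.+1%:R)) <= 80 * ln L.+1%:R :> R.
  have : ln (4 * L.+1%:R) <= ln (L.+1%:R ^+ 3) :> R.
    rewrite ler_ln ?posrE ?mulr_gt0 ?exprn_gt0// -natrX -natrM ler_nat.
    by rewrite expnS mulnC leq_mul2l/= (@leq_exp2r 2 _ 2).
  by rewrite lnXn// -[_ *+ 3]mulr_natl; lra.
have K4 : K.+1%:R ^+ 2 <= 4 * K%:R ^+ 2 :> R.
  by rewrite -!natrX -natrM ler_nat; nia.
have SD : S <= L.+1%:R * (2 * N * D).
  apply: le_trans (sum_moves_le K (ltn0Sn L) _) _ => [p|].
    exact: hellinger_ge0.
  rewrite ler_wpM2l// /D /dirichlet.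
  have -> : 2 * N * (2^-1 * \sum_x \sum_y (rho y - rho x) *
      (ln (rho y) - ln (rho x)) * zrp_rate R x y * zrp_measure R x) =
    \sum_x \sum_y (rho y - rho x) * (ln (rho y) - ln (rho x)) * zrp_rate R x y.
    have half X : 2 * N * (2^-1 * X) = N * X by field.
    rewrite half mulr_sumr; apply: eq_bigr => x _.
    rewrite mulr_sumr; apply: eq_bigr => y _.
    by rewrite mulrCA /zrp_measure divff ?mulr1.
  apply: ler_sum => x _; apply: ler_sum => y _.
  rewrite ler_wpM2r ?zrp_rate_ge0// !fE.
  by rewrite -mulrNN !opprB hellinger_le_ln.
have S0 : 0 <= S by apply: sumr_ge0 => p _; exact: hellinger_ge0.
have -> : entropy (@zrp_measure R K L.+1) rho = N^-1 * H.
  rewrite /entropy mulr_sumr; apply: eq_bigr => x _; by rewrite -mulrA.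
rewrite ler_pdivrMl//.
have K0 : (0 : R) < K%:R by rewrite ltr0n.
have -> : N * ((2 * (1280^-1 / (K%:R ^+ 2 * L.+1%:R * ln L.+1%:R)))^-1 * D) =
   80 * ln L.+1%:R * (4 * K%:R ^+ 2) * (L.+1%:R * (2 * N * D)).
  have : K%:R != 0 :> R by rewrite gt_eqF.
  have : L.+1%:R != 0 :> R by rewrite pnatr_eq0.
  have : ln L.+1%:R != 0 :> R by rewrite gt_eqF//; lra.
  move: (K%:R) (L.+1%:R) (ln _) => k l g g0 l0 k0.
  by field; rewrite g0 l0 k0.
apply: (le_trans HS).
have A0 : 0 <= 16 * (1 + ln (4 * L.+1%:R)) :> R.
  by rewrite mulr_ge0// addr_ge0// ln_ge0// -natrM ler1n.
apply: ler_pM => //; first by apply: mulr_ge0 => //; exact: sqr_ge0.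
by apply: ler_pM => //; exact: sqr_ge0.
Qed.
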